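(* The group $SO(4,1)$ acts transitively through conformal diffeomorphisms on $\mathbb{R}^3\cup\{\infty\}$ and on $\mathbb{S}^3$. More precisely: (i) For $M\in SO(4,1)$ and $X\in\mathbb{S}^3\subset\mathbb{R}^4$, the action of $M$ on $X$ is given by $$M.X=\frac{V_\circ}{V_5},\qquad\text{where } V=M\begin{pmatrix} X \\ 1 \end{pmatrix}=\begin{pmatrix} V_\circ \\ V_5 \end{pmatrix},\quad V_\circ\in\mathbb{R}^4,\ V_5\in\mathbb{R}.$$ (ii) For $M\in SO(4,1)$ and $x\in\mathbb{R}^3$, the action of $M$ on $x$ is given by $$M.x=\frac{y_\diamond}{y_5-y_4},\qquad\text{where } y=M\begin{pmatrix} x \\ \frac{|x|^2-1}{2} \\ \frac{|x|^2+1}{2} \end{pmatrix}=\begin{pmatrix} y_\diamond \\ y_4 \\ y_5 \end{pmatrix},\quad y_\diamond\in\mathbb{R}^3,\ y_4,y_5\in\mathbb{R}.$$ That is, these formulas define transitive group actions of $SO(4,1)$ on $\mathbb{S}^3$ and on $\mathbb{R}^3\cup\{\infty\}$, in which every element acts as a conformal diffeomorphism.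
   Context: $\mathbb{R}^{4,1}$ is $\mathbb{R}^5$ with the Lorentzian product $\langle u,v\rangle=\sum_{i=1}^4u_iv_i-u_5v_5$. $SO(4,1)$ is the group of real $5\times5$ matrices of determinant $1$ preserving this product (it is not restricted to the identity component). $\mathbb{S}^3$ is the unit sphere of $\mathbb{R}^4$. $\mathbb{R}^3\cup\{\infty\}$ is identified conformally with $\mathbb{S}^3$ through the stereographic projection $\pi(x,y,z,t)=\frac{1}{1-t}(x,y,z)$ from the north pole $N=(0,0,0,1)$, with $\pi(N)=\infty$. Conformal diffeomorphisms may reverse orientation. In (ii) the quotient is read as $\infty$ when $y_5-y_4=0$, and the point $\infty$ is represented by the vector $(0,0,0,1,1)^T$, i.e. $M.\infty$ is computed by the same quotient with $y=M(0,0,0,1,1)^T$. *)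

(* Defs.v *)
From HB Require Import structures.
From mathcomp Require Import all_boot all_order all_algebra.
From mathcomp Require Import all_classical all_reals all_analysis.

Set Implicit Arguments.
Unset Strict Implicit.
Unset Printing Implicit Defensive.

Import Order.TTheory GRing.Theory Num.Theory.
Import numFieldNormedType.Exports.

Local Open Scope classical_set_scope.
Local Open Scope ring_scope.

Section GroupActions.
Context {R : realType} {n : nat} {T : Type}.
Implicit Types (G : set 'M[R]_n) (S : set T) (act : 'M[R]_n -> T -> T).

Definition matrix_group G :=
  [/\ G 1%:M,
      forall M N, G M -> G N -> G (M *m N) &
      forall M, G M -> M \in unitmx /\ G (invmx M)].

Definition group_action G S act :=
  [/\ matrix_group G,
      forall M x, G M -> S x -> S (act M x),
      forall x, S x -> act 1%:M x = x &
      forall M N x, G M -> G N -> S x -> act (M *m N) x = act M (act N x)].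

Definition transitive_action G S act :=
  group_action G S act /\
  (forall x y, S x -> S y -> exists2 M, G M & act M x = y).

End GroupActions.

Section Smoothness.
Context {R : realType} {V W : normedModType R}.

(* [f] is of class C^k on the open set [U].  For finite-dimensional [V],
   continuity of ['d f] is equivalent to that of all the [x |-> 'D_v f x]. *)
Fixpoint class_C (k : nat) (U : set V) (f : V -> W) : Prop :=
  if k is k'.+1 then
    (forall x, U x -> differentiable f x) /\
    (forall v, class_C k' U (fun x => 'D_v f x))
  else forall x, U x -> {for x, continuous f}.

Definition smooth_open (U : set V) (f : V -> W) := forall k, class_C k U f.

Definition local_smooth_extension (S : set V) (f : V -> W) (p : V)
    (U : set V) (g : V -> W) :=
  [/\ open U, U p, smooth_open U g & forall x, U x -> S x -> g x = f x].

(* Smoothness of a map defined on a subset [S]; the values of [f] outside [S]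
   are irrelevant. *)
Definition smooth_on (S : set V) (f : V -> W) :=
  forall p, S p -> exists U g, local_smooth_extension S f p U g.

End Smoothness.

Section Conformal.
Context {R : realType}.

Definition dot {n} (u v : 'cV[R]_n) : R := \sum_(i < n) u i 0 * v i 0.

Definition sphere3 : set 'cV[R]_4 := [set X | dot X X = 1].

Definition tangent_sphere3 (p : 'cV[R]_4) : set 'cV[R]_4 :=
  [set v | dot p v = 0].

Definition diffeo_sphere3 (f : 'cV[R]_4 -> 'cV[R]_4) :=
  [/\ set_fun sphere3 sphere3 f, smooth_on sphere3 f &
      exists g, [/\ set_fun sphere3 sphere3 g, smooth_on sphere3 g,
        forall x, sphere3 x -> g (f x) = x &
        forall x, sphere3 x -> f (g x) = x]].

(* The differential of [f] at [p] is the restriction of ['d g p] to the tangent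
   space, which does not depend on the local extension [g]. No condition is put
   on the orientation. *)
Definition conformal_sphere3_at (f : 'cV[R]_4 -> 'cV[R]_4) (p : 'cV[R]_4) :=
  exists U g, local_smooth_extension sphere3 f p U g /\
    exists2 lambda : R, 0 < lambda &
      forall u v, tangent_sphere3 p u -> tangent_sphere3 p v ->
        dot ('d g p u) ('d g p v) = lambda * dot u v.

Definition conformal_diffeo_sphere3 (f : 'cV[R]_4 -> 'cV[R]_4) :=
  diffeo_sphere3 f /\ (forall p, sphere3 p -> conformal_sphere3_at f p).

(* The underlying type is [option 'cV[R]_3], with [None] the point at infinity. *)
Definition R3oo := one_point_compactification 'cV[R]_3.

Definition stereo (X : 'cV[R]_(3 + 1)) : R3oo :=
  let t := dsubmx X 0 0 in
  if t == 1 then None else Some ((1 - t)^-1 *: usubmx X).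

(* The conformal structure on R^3 U {oo} is the one transported from the sphere
   by the bijection [stereo : sphere3 -> R3oo]. *)
Definition conformal_diffeo_R3oo (f : R3oo -> R3oo) :=
  exists2 F, conformal_diffeo_sphere3 F &
    forall X, sphere3 X -> stereo (F X) = f (stereo X).

End Conformal.

Section Lorentz.
Context {R : realType}.

Definition lorentz (u v : 'cV[R]_(4 + 1)) : R :=
  dot (usubmx u) (usubmx v) - dsubmx u 0 0 * dsubmx v 0 0.

Definition SO41 : set 'M[R]_5 :=
  [set M | \det M = 1 /\ forall u v, lorentz (M *m u) (M *m v) = lorentz u v].

Definition lift_sphere3 (X : 'cV[R]_4) : 'cV[R]_(4 + 1) :=
  col_mx X (const_mx 1).

Definition act_sphere3 (M : 'M[R]_5) (X : 'cV[R]_4) : 'cV[R]_4 :=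
  let V : 'cV[R]_(4 + 1) := M *m lift_sphere3 X in
  (dsubmx V 0 0)^-1 *: usubmx V.

Definition lift_R3oo (x : @R3oo R) : 'cV[R]_(3 + (1 + 1)) :=
  if x is Some x then
    col_mx x (col_mx (const_mx ((dot x x - 1) / 2))
                     (const_mx ((dot x x + 1) / 2)))
  else col_mx 0 (col_mx (const_mx 1) (const_mx 1)).

Definition act_R3oo (M : 'M[R]_5) (x : @R3oo R) : @R3oo R :=
  let y : 'cV[R]_(3 + (1 + 1)) := M *m lift_R3oo x in
  let y4 := usubmx (dsubmx y) 0 0 in
  let y5 := dsubmx (dsubmx y) 0 0 in
  if y5 - y4 == 0 then None else Some ((y5 - y4)^-1 *: usubmx y).

End Lorentz.

(* Main.v *)
(* Both spaces are models of the projectivized light cone of [R^{4,1}]: the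
   lifts [(X, 1)] and [(x, (|x|^2-1)/2, (|x|^2+1)/2)] are two affine sections of
   it, and [stereo] identifies two points exactly when their lifts are
   proportional. Hence [M] acts on both by its linear action on null vectors,
   and everything on [R^3 U {oo}] is transported from the sphere.
   For [V = M (X, 1)], the denominator [V_5] is nonzero because [V] is a nonzero
   null vector.  Differentiating [V_o / V_5] along tangent vectors, the terms
   involving [dV_5] cancel thanks to [<V, V> = <V, dV> = 0], which leaves
   [V_5^-2] times the Lorentz product of the [dV]'s: this is conformality, with
   factor [V_5^-2].  For transitivity, if [x + y <> 0] the reflection along
   [x + y] sends [x] to [-y], so its sum with the time reversal [-1] lies in
   [SO(4,1)] and sends [x] to [y]. *)
Require Import Defs.
From mathcomp Require Import all_boot all_order all_algebra.
From mathcomp Require Import all_classical all_reals all_analysis.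
From mathcomp Require Import ring.

Import Order.TTheory GRing.Theory Num.Theory.
Import numFieldNormedType.Exports.
Local Open Scope classical_set_scope.
Local Open Scope ring_scope.

Set Implicit Arguments.
Unset Strict Implicit.
Unset Printing Implicit Defensive.

(** * Closure properties of maps of class C^k on an open set *)

Section ClassC.
Context {R : realType} {V W : normedModType R}.
Implicit Types (U : set V) (k : nat).

(** Differentiability depends only on the germ: the first-order expansion of [f] at [x] also expands
    [g], and uniqueness of the differential identifies ['d g x] with ['d f x]. *)
Lemma near_eq_differentiable (f g : V -> W) (x : V) :
  (\forall y \near x, f y = g y) -> differentiable f x -> differentiable g x.
Proof.
move=> fg df.
have gx : g \o shift x = cst (g x) + 'd f x +o_ 0 id.
  apply/eqaddoP => e e0.
  have /eqaddoP/(_ _ e0) := diff_locally df.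
  have : \forall y \near (0 : V), f (y + x) = g (y + x).
    move: fg; rewrite (near_shift 0) subr0; exact: filterS.
  apply: filterS2 => y fgy.
  by rewrite /= !fctE /= -fgy -(nbhs_singleton fg).
have dgf : 'd g x = 'd f x :> (V -> W).
  by apply: diff_unique gx; exact: diff_continuous.
by apply/diff_locallyP; rewrite dgf; split=> //; exact: diff_continuous.
Qed.

Lemma class_C_cst k U (c : W) : class_C k U (fun=> c).
Proof.
elim: k c => [|k IHk] c /=; first by move=> x _; exact: cst_continuous.
split=> [x _|v]; first exact: differentiable_cst.
have -> : (fun x => 'D_v (fun=> c) x) = fun=> 0 :> W.
  by apply/funext => x; exact: derive_cst.
exact: IHk.
Qed.

(** The rules for derivatives are only available at points of [U]; as [U] is open, an identity on
    [U] holds near each of its points, so it survives further differentiation. *)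
Lemma eq_on_class_C k U (f g : V -> W) :
  open U -> (forall x, U x -> f x = g x) -> class_C k U f -> class_C k U g.
Proof.
move=> oU; elim: k f g => [|k IHk] f g fg /=.
  move=> Cf x Ux; have nU : nbhs x U by exact: open_nbhs_nbhs.
  rewrite /prop_for /continuous_at -(fg x Ux).
  apply: cvg_trans (Cf x Ux); apply: near_eq_cvg.
  by apply: filterS nU => y Uy; exact: fg.
move=> [df Df]; split=> [x Ux|v].
  have nU : nbhs x U by exact: open_nbhs_nbhs.
  have nfg : \forall y \near x, f y = g y by apply: filterS nU => y; exact: fg.
  exact: near_eq_differentiable nfg (df x Ux).
apply: IHk (Df v) => x Ux; apply: near_eq_derive.
have nU : nbhs x U by exact: open_nbhs_nbhs.
by apply: filterS nU => y; exact: fg.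
Qed.

Lemma class_CW k U (f : V -> W) : class_C k.+1 U f -> class_C k U f.
Proof.
elim: k f => [|k IHk] f [df Df].
  by move=> x /df; exact: differentiable_continuous.
by split=> // v; apply: IHk; exact: Df.
Qed.

Lemma class_CD k U (f g : V -> W) : open U ->
  class_C k U f -> class_C k U g -> class_C k U (fun x => f x + g x).
Proof.
move=> oU; elim: k f g => [|k IHk] f g.
  by move=> Cf Cg x Ux; apply: continuousD; [exact: Cf|exact: Cg].
move=> [df Df] [dg Dg]; split=> [x Ux|v].
  by apply: differentiableD; [exact: df|exact: dg].
apply: (eq_on_class_C oU) (IHk _ _ (Df v) (Dg v)) => x Ux.
by rewrite -deriveD//; apply: diff_derivable; [exact: df|exact: dg].
Qed.

End ClassC.

Section ClassCScalar.
Context {R : realType} {V : normedModType R}.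
Implicit Types (U : set V) (k : nat) (f g : V -> R).

Lemma class_CM k U f g : open U ->
  class_C k U f -> class_C k U g -> class_C k U (fun x => f x * g x).
Proof.
move=> oU; elim: k f g => [|k IHk] f g.
  by move=> Cf Cg x Ux; apply: continuousM; [exact: Cf|exact: Cg].
move=> Cf Cg; have [df Df] := Cf; have [dg Dg] := Cg; split=> [x Ux|v].
  by apply: differentiableM; [exact: df|exact: dg].
(* Leibniz rule: each term pairs a derivative of class C^k with an undifferentiated factor, whose
   class is lowered to k. *)
have C1 := IHk _ _ (class_CW Cf) (Dg v).
have C2 := IHk _ _ (class_CW Cg) (Df v).
apply: (eq_on_class_C oU) (class_CD oU C1 C2) => x Ux.
by rewrite [RHS](@deriveM _ _ f g)//; apply: diff_derivable; [exact: df|exact: dg].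
Qed.

Lemma class_CV k U f : open U -> (forall x, U x -> f x != 0) ->
  class_C k U f -> class_C k U (fun x => (f x)^-1).
Proof.
move=> oU f0; elim: k => [|k IHk].
  by move=> Cf x Ux; apply: continuousV; [exact: f0|exact: Cf].
move=> Cf; have [df Df] := Cf; split=> [x Ux|v].
  by apply: differentiableV; [exact: df|exact: f0].
have Ci := IHk (class_CW Cf).
(* The derivative of [f^-1] is [- f^-2 * 'D_v f], assembled here from the induction hypothesis for
   [f^-1] and the constant -1. *)
have := class_CM oU (class_CM oU Ci Ci) (Df v).
move/(class_CM oU (@class_C_cst _ _ R k U (-1))).
apply: (eq_on_class_C oU) => x Ux.
rewrite [RHS](@deriveV _ _ f); last 2 first.
- exact: f0.
- by apply: diff_derivable; exact: df.
by rewrite mulN1r -exprVn expr2 scaleNr.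
Qed.

Lemma class_CZl (W : normedModType R) k U f (w : W) : open U ->
  class_C k U f -> class_C k U (fun x => f x *: w).
Proof.
move=> oU; elim: k f => [|k IHk] f.
  by move=> Cf x Ux; apply: continuousZr_tmp; exact: Cf.
move=> [df Df]; split=> [x Ux|v]; first by apply: differentiableZl; exact: df.
apply: (eq_on_class_C oU) (IHk _ (Df v)) => x Ux.
rewrite (deriveE _ (df x Ux)) deriveE; last by apply: differentiableZl; exact: df.
by rewrite diffZl//; exact: df.
Qed.

Lemma class_C_sum (W : normedModType R) k U (I : finType) (F : I -> V -> W) :
  open U -> (forall i, class_C k U (F i)) -> class_C k U (fun x => \sum_i F i x).
Proof.
move=> oU CF; rewrite (_ : (fun x => _) = \sum_i F i).
  elim/big_ind : _ => // [|f g]; first exact: class_C_cst.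
  exact: class_CD.
by apply/funext => x; rewrite fct_sumE.
Qed.

End ClassCScalar.

(** * Affine functionals on column vectors *)

Section Affine.
Context {R : realType} {n : nat}.
Implicit Types (x v : 'cV[R]_n) (r : 'rV[R]_n) (b : R).

Lemma is_derive_coord x v i :
  is_derive x v (fun y : 'cV[R]_n => y i 0) (v i 0).
Proof.
apply: DeriveDef.
  by apply: diff_derivable; exact: differentiable_coord.
(* A coordinate is an entry of the identity map, whose derivative is taken entrywise. *)
have /derive_mx : derivable (id : 'cV[R]_n -> 'cV[R]_n) x v by exact: derivable_id.
by rewrite (derive_id x v) => /matrixP/(_ i 0) ->; rewrite mxE.
Qed.

Let affineE r b :
  (fun x => (r *m x) 0 0 + b) = \sum_i (fun x => r 0 i * x i 0) + (fun=> b).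
Proof. by apply/funext => x; rewrite !fctE fct_sumE mxE. Qed.

Lemma is_derive_affine r b x v :
  is_derive x v (fun y => (r *m y) 0 0 + b) ((r *m v) 0 0).
Proof.
rewrite affineE mxE -[X in is_derive _ _ _ X]addr0.
apply: is_deriveD; apply: is_derive_sum => i.
have := @is_derive_coord x v i; exact: is_deriveZ.
Qed.

Lemma class_C_affine k (U : set 'cV[R]_n) r b : open U ->
  class_C k U (fun y => (r *m y) 0 0 + b).
Proof.
move=> oU; apply: (class_CD oU); last exact: class_C_cst.
have -> : (fun y : 'cV[R]_n => (r *m y) 0 0) = fun y => \sum_i r 0 i * y i 0.
  by apply/funext => y; rewrite mxE.
apply: class_C_sum => // i; apply: class_CM => //; first exact: class_C_cst.
case: k => [|k] /=; first by move=> x _; exact: coord_continuous.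
split=> [x _|v]; first exact: differentiable_coord.
rewrite (_ : derive _ ^~ v = fun=> v i 0); first exact: class_C_cst.
by apply/funext => x; have [_ ->] := is_derive_coord x v i.
Qed.

End Affine.

(** * The Euclidean inner product *)

Section Dot.
Context {R : realType} {n : nat}.
Implicit Types (u v w : 'cV[R]_n) (c : R).

Lemma dotE u v : dot u v = (u^T *m v) 0 0.
Proof. by rewrite mxE; apply: eq_bigr => i _; rewrite mxE. Qed.

Lemma dotC u v : dot u v = dot v u.
Proof. by apply: eq_bigr => i _; rewrite mulrC. Qed.

Lemma dotDr u v w : dot u (v + w) = dot u v + dot u w.
Proof. by rewrite !dotE mulmxDr mxE. Qed.

Lemma dotZr u c v : dot u (c *: v) = c * dot u v.
Proof. by rewrite !dotE -scalemxAr mxE. Qed.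

Lemma dotDl u v w : dot (u + v) w = dot u w + dot v w.
Proof. by rewrite dotC dotDr !(dotC w). Qed.

Lemma dotZl u c v : dot (c *: u) v = c * dot u v.
Proof. by rewrite dotC dotZr dotC. Qed.

Lemma dot_eq0 u : (dot u u == 0) = (u == 0).
Proof.
apply/idP/eqP => [|->]; last by rewrite /dot big1// => i _; rewrite !mxE mulr0.
rewrite psumr_eq0 => [/allP u0|i _]; last by rewrite -expr2 sqr_ge0.
apply/colP => i; rewrite mxE; apply/eqP.
by have := u0 i (mem_index_enum i); rewrite mulf_eq0 orbb.
Qed.

End Dot.

(** * The group SO(4,1), null vectors and the action on the sphere *)

Section SO41.
Context {R : realType}.
Implicit Types (M N : 'M[R]_5) (X Y : 'cV[R]_4).

Lemma lorentz_col_mx X Y (a b : R) :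
  lorentz (col_mx X (const_mx a)) (col_mx Y (const_mx b)) = dot X Y - a * b.
Proof. by rewrite /lorentz !col_mxKu !col_mxKd !mxE. Qed.

Lemma SO41_unitmx M : SO41 M -> M \in unitmx.
Proof. by case=> detM _; rewrite unitmxE detM unitr1. Qed.

Lemma SO41_matrix_group : matrix_group (@SO41 R).
Proof.
split=> [|M N [detM M_L] [detN N_L]|M SM].
- by split=> [|u v]; rewrite ?det1// !mul1mx.
- split=> [|u v]; first by rewrite det_mulmx detM detN mulr1.
  by rewrite -!mulmxA M_L N_L.
- have uM := SO41_unitmx SM; split=> //; case: SM => detM M_L.
  split=> [|u v]; first by rewrite det_inv detM invr1.
  by rewrite -M_L !mulKVmx.
Qed.

Lemma lift_sphere3_neq0 X : lift_sphere3 X != 0.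
Proof.
apply/eqP => /(congr1 (fun V : 'cV[R]_(4 + 1) => dsubmx V 0 0)).
by rewrite col_mxKd !mxE => /eqP; rewrite oner_eq0.
Qed.

Lemma lorentz_lift_sphere3 X : sphere3 X -> lorentz (lift_sphere3 X) (lift_sphere3 X) = 0.
Proof. by move=> SX; rewrite lorentz_col_mx SX mulr1 subrr. Qed.

(** If the last coordinate vanished, nullity would give the spatial part Euclidean norm zero,
    forcing [V = 0]. *)
Lemma null_last_neq0 (V : 'cV[R]_(4 + 1)) :
  lorentz V V = 0 -> V != 0 -> dsubmx V 0 0 != 0.
Proof.
move=> VV; apply: contra_neq => V5; apply/eqP; move: VV.
rewrite /lorentz V5 mulr0 subr0 => /eqP; rewrite dot_eq0 => /eqP V0.
by rewrite -(vsubmxK V) V0 (mx11_scalar (dsubmx V)) V5 raddf0 col_mx0.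
Qed.

Lemma act_sphere3_last_neq0 M X : SO41 M -> sphere3 X ->
  dsubmx (M *m lift_sphere3 X : 'cV[R]_(4 + 1)) 0 0 != 0.
Proof.
move=> SM SX; apply: null_last_neq0.
  by case: SM => _ ->; exact: lorentz_lift_sphere3.
apply: contra (lift_sphere3_neq0 X) => /eqP MX0.
by rewrite -(mulKmx (SO41_unitmx SM) (lift_sphere3 X)) MX0 mulmx0.
Qed.

Lemma lift_sphere3_normalize (V : 'cV[R]_(4 + 1)) : dsubmx V 0 0 != 0 ->
  V = dsubmx V 0 0 *: lift_sphere3 ((dsubmx V 0 0)^-1 *: usubmx V).
Proof.
move=> V5; rewrite /lift_sphere3 scale_col_mx scalerA divff// scale1r.
rewrite -[LHS]vsubmxK; congr col_mx; apply/matrixP => i j.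
by rewrite !ord1 [RHS]mxE [const_mx _ _ _]mxE mulr1.
Qed.

(** Expresses the action as the linear action on null lines; stability, composition and the
    comparison with R^3 U {oo} all reduce to rescaling. *)
Lemma lift_act_sphere3 M X : SO41 M -> sphere3 X ->
  M *m lift_sphere3 X =
  dsubmx (M *m lift_sphere3 X : 'cV[R]_(4 + 1)) 0 0 *: lift_sphere3 (act_sphere3 M X).
Proof.
by move=> SM SX; apply: lift_sphere3_normalize; exact: act_sphere3_last_neq0.
Qed.

Lemma sphere3_of_null X : lorentz (lift_sphere3 X) (lift_sphere3 X) = 0 -> sphere3 X.
Proof. by rewrite lorentz_col_mx mulr1 => /eqP; rewrite subr_eq0 => /eqP. Qed.

Lemma lorentzZ (c : R) (V : 'cV[R]_(4 + 1)) :
  lorentz (c *: V) (c *: V) = c ^+ 2 * lorentz V V.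
Proof.
have uZ : usubmx (c *: V) = c *: usubmx V by apply/matrixP => i j; rewrite !mxE.
have dZ : dsubmx (c *: V) 0 0 = c * dsubmx V 0 0 by rewrite !mxE.
by rewrite /lorentz uZ dZ dotZr dotZl; ring.
Qed.

Lemma act_sphere3_stable M X : SO41 M -> sphere3 X -> sphere3 (act_sphere3 M X).
Proof.
move=> SM SX; apply: sphere3_of_null; have := lorentz_lift_sphere3 SX.
have V5 := act_sphere3_last_neq0 SM SX; have := SM.2 (lift_sphere3 X) (lift_sphere3 X).
move=> <-; rewrite lift_act_sphere3// lorentzZ => /eqP.
by rewrite mulf_eq0 sqrf_eq0 (negPf V5) => /eqP.
Qed.

Lemma act_sphere3_comp M N X : SO41 M -> SO41 N -> sphere3 X ->
  act_sphere3 (M *m N) X = act_sphere3 M (act_sphere3 N X).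
Proof.
move=> SM SN SX; have V5 := act_sphere3_last_neq0 SN SX.
(* The scalar produced by normalizing after [N] factors out of both numerator and denominator, and
   cancels. *)
rewrite {1}/act_sphere3 -mulmxA (lift_act_sphere3 SN SX) -scalemxAr.
rewrite /act_sphere3; set W := M *m lift_sphere3 (act_sphere3 N X); move: V5.
set c := (dsubmx _ 0 0) => c0.
have -> : usubmx (c *: W : 'cV_(4 + 1)) = c *: usubmx (W : 'cV_(4 + 1)).
  by apply/matrixP => i j; rewrite !mxE.
have -> : dsubmx (c *: W : 'cV_(4 + 1)) 0 0 = c * dsubmx (W : 'cV_(4 + 1)) 0 0.
  by rewrite !mxE.
by rewrite invfM scalerA mulrAC mulVf ?mul1r.
Qed.

Lemma act_sphere3_1 X : act_sphere3 1%:M X = X.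
Proof. by rewrite /act_sphere3 mul1mx col_mxKu col_mxKd mxE invr1 scale1r. Qed.

Lemma group_action_sphere3 : group_action SO41 (@sphere3 R) act_sphere3.
Proof.
split; [exact: SO41_matrix_group|exact: act_sphere3_stable| |exact: act_sphere3_comp].
by move=> x _; exact: act_sphere3_1.
Qed.

End SO41.

(** * Reflections and transitivity on the sphere *)

Section Transitivity.
Context {R : realType}.

(* Sylvester's determinant identity: the unipotent matrix [[1, 0], [B, 1]]
   conjugates [[1 + A B, A], [0, 1]] to [[1, A], [0, 1 + B A]]. *)
Lemma det_1addMC m n (A : 'M[R]_(m, n)) (B : 'M[R]_(n, m)) :
  \det (1%:M + A *m B) = \det (1%:M + B *m A).
Proof.
have H : block_mx 1%:M 0 B 1%:M *m block_mx (1%:M + A *m B) A 0 1%:M =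
    block_mx 1%:M A 0 (1%:M + B *m A) *m block_mx 1%:M 0 B 1%:M.
  rewrite !mulmx_block !(mul1mx, mulmx1, mul0mx, mulmx0, addr0, add0r).
  by rewrite mulmxDr mulmxDl mulmx1 mul1mx mulmxA addrC [B *m A + _]addrC.
move/(congr1 determinant): H; rewrite !det_mulmx !det_lblock !det_ublock !det1.
by rewrite !(mul1r, mulr1).
Qed.

Context {n : nat}.
Implicit Types (w u v x y : 'cV[R]_n).

Definition reflection w : 'M[R]_n := 1%:M - (2 / dot w w) *: (w *m w^T).

Lemma mul_reflection w u : reflection w *m u = u + - (2 * dot w u / dot w w) *: w.
Proof.
rewrite scaleNr mulmxBl mul1mx -scalemxAl -mulmxA (mx11_scalar (w^T *m u)) -dotE.
by rewrite mul_mx_scalar scalerA mulrAC.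
Qed.

Lemma dot_reflection w u v : w != 0 ->
  dot (reflection w *m u) (reflection w *m v) = dot u v.
Proof.
rewrite -dot_eq0 => ww; rewrite !mul_reflection.
rewrite !(dotDl, dotDr, dotZl, dotZr) (dotC u w); field.
exact: ww.
Qed.

(** A rank-one perturbation of the identity: [det_1addMC] reduces it to the 1 x 1 determinant
    [1 - 2 * (dot w w / dot w w)]. *)
Lemma det_reflection w : w != 0 -> \det (reflection w) = -1.
Proof.
rewrite -dot_eq0 => ww.
rewrite /reflection -[- (_ *: _)]scaleNr scalemxAl det_1addMC det_mx11 !mxE eqxx.
rewrite (eq_bigr (fun i => - (2 / dot w w) * (w i 0 * w i 0))); last first.
  by move=> i _; rewrite !mxE; ring.
rewrite mulr1n -mulr_sumr -/(dot w w); field; exact: ww.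
Qed.

(** Equal norms give [|x + y|^2 = 2 (x + y).x], so the reflection subtracts exactly [x + y] from
    [x]. *)
Lemma reflection_addr x y : dot x x = dot y y -> x + y != 0 ->
  reflection (x + y) *m x = - y.
Proof.
move=> xy; rewrite -dot_eq0 => ww.
have E : dot (x + y) (x + y) = 2 * dot (x + y) x.
  by rewrite !(dotDl, dotDr) -xy (dotC x y); ring.
by rewrite mul_reflection -E divff// scaleN1r opprD addNKr.
Qed.

End Transitivity.

Section TransitiveSphere.
Context {R : realType}.
Implicit Types (x y : 'cV[R]_4) (Q : 'M[R]_4).

Lemma SO41_block Q (s : R) : s ^+ 2 = 1 -> \det Q * s = 1 ->
  (forall u v, dot (Q *m u) (Q *m v) = dot u v) -> 
  SO41 (block_mx Q 0 0 s%:M : 'M[R]_(4 + 1)).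
Proof.
move=> s2 dQ QO; split=> [|u v].
  by rewrite det_ublock det_scalar1.
rewrite /lorentz -(vsubmxK u) -(vsubmxK v) !mul_block_col !mul0mx !addr0 !add0r.
rewrite !col_mxKu !col_mxKd QO !mul_scalar_mx.
by congr (_ - _); rewrite !mxE mulrACA -expr2 s2 mul1r.
Qed.

Lemma act_sphere3_block Q (s : R) x :
  act_sphere3 (block_mx Q 0 0 s%:M : 'M[R]_(4 + 1)) x = s^-1 *: (Q *m x).
Proof.
have E : (block_mx Q 0 0 s%:M : 'M[R]_(4 + 1)) *m lift_sphere3 x =
    col_mx (Q *m x) (const_mx s).
  rewrite mul_block_col !mul0mx addr0 add0r mul_scalar_mx; congr col_mx.
  by apply/matrixP => i j; rewrite !mxE mulr1.
by rewrite /act_sphere3 E col_mxKu col_mxKd mxE.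
Qed.

Lemma transitive_action_sphere3 :
  transitive_action SO41 (@sphere3 R) act_sphere3.
Proof.
split=> [|x y Sx Sy]; first exact: group_action_sphere3.
have [xy0|xy] := eqVneq (x + y) 0.
  (* Here [y = - x], and the antipodal map has determinant 1 because the dimension 4 is even. *)
  exists (block_mx (- 1%:M) 0 0 1%:M : 'M[R]_(4 + 1)).
    apply: SO41_block => [||u v]; first exact: expr1n.
      by rewrite -scaleN1r detZ det1 !mulr1; ring.
    by rewrite -scaleN1r -!scalemxAl !mul1mx dotZr dotZl; ring.
  rewrite act_sphere3_block invr1 scale1r mulNmx mul1mx.
  by apply/eqP; rewrite eqr_oppLR -addr_eq0 xy0.
(* The entry -1 compensates the determinant of the reflection, and dividing by it turns [- y] into
   [y]. *)
exists (block_mx (reflection (x + y)) 0 0 (-1)%:M : 'M[R]_(4 + 1)).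
  apply: SO41_block => [||u v]; first by rewrite sqrrN expr1n.
    by rewrite det_reflection// mulrNN mulr1.
  exact: dot_reflection.
rewrite act_sphere3_block reflection_addr//; last by rewrite Sx Sy.
by rewrite invrN invr1 scaleN1r opprK.
Qed.

End TransitiveSphere.

(** * Smoothness and conformality of the action on the sphere *)

Lemma mul_mx_col (R : pzRingType) m n1 n2 p (A : 'M[R]_(m, n1 + n2))
    (B : 'M[R]_(n1, p)) (C : 'M[R]_(n2, p)) :
  A *m col_mx B C = lsubmx A *m B + rsubmx A *m C.
Proof. by rewrite -{1}(hsubmxK A) mul_row_col. Qed.

Section Conformal.
Context {R : realType}.
Implicit Types (M : 'M[R]_5) (X u v : 'cV[R]_4).

Lemma mul_lift_sphere3E M i X :
  (M *m lift_sphere3 X) i 0 =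
  (row i (lsubmx (M : 'M[R]_(5, 4 + 1))) *m X) 0 0
  + (rsubmx (M : 'M[R]_(5, 4 + 1)) *m const_mx 1 : 'cV_5) i 0.
Proof.
rewrite -row_mul [X in _ = X + _]mxE.
by rewrite (mul_mx_col (M : 'M[R]_(5, 4 + 1))) [LHS]mxE.
Qed.

Lemma class_C_mul_lift_sphere3 k (U : set 'cV[R]_4) M i : open U ->
  class_C k U (fun X => (M *m lift_sphere3 X) i 0).
Proof.
by move=> oU; under eq_fun do rewrite mul_lift_sphere3E; exact: class_C_affine.
Qed.

Lemma is_derive_mul_lift_sphere3 M i X u :
  is_derive X u (fun X => (M *m lift_sphere3 X) i 0)
    ((M *m (col_mx u 0 : 'cV_(4 + 1))) i 0).
Proof.
under eq_fun do rewrite mul_lift_sphere3E.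
have -> : (M *m (col_mx u 0 : 'cV_(4 + 1))) i 0 =
    (row i (lsubmx (M : 'M[R]_(5, 4 + 1))) *m u) 0 0.
  rewrite (mul_mx_col (M : 'M[R]_(5, 4 + 1))).
  by rewrite mulmx0 addr0 -row_mul [RHS]mxE.
exact: is_derive_affine.
Qed.

(** For [M] in [SO41] this is an open neighbourhood of the sphere, on which the formula for the
    action is its own smooth extension. *)
Definition finite_locus M : set 'cV[R]_4 :=
  [set X | dsubmx (M *m lift_sphere3 X : 'cV[R]_(4 + 1)) 0 0 != 0].

Lemma finite_locusE M : finite_locus M =
  [set X | (M *m lift_sphere3 X) (rshift 4 (0 : 'I_1)) 0 != 0].
Proof. by apply/funext => X; rewrite /finite_locus /= [dsubmx _ _ _]mxE. Qed.

Lemma open_finite_locus M : open (finite_locus M).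
Proof.
rewrite finite_locusE.
apply: (@open_comp _ _ _ [set x : R | x != 0]); last exact: open_neq.
move=> X _.
have := @class_C_mul_lift_sphere3 0 setT M (rshift 4 (0 : 'I_1)) openT X I; exact.
Qed.

Lemma smooth_act_sphere3 M : smooth_open (finite_locus M) (act_sphere3 M).
Proof.
move=> k; have oU := @open_finite_locus M.
(* Expansion in the standard basis reduces smoothness to quotients of scalar affine functions. *)
have -> : act_sphere3 M = fun X => \sum_(i < 4)
    (((M *m lift_sphere3 X) (rshift 4 (0 : 'I_1)) 0)^-1
      * (M *m lift_sphere3 X) (lshift 1 i) 0) *: delta_mx i 0.
  apply/funext => X; rewrite /act_sphere3 [LHS]matrix_sum_delta.
  by apply: eq_bigr => i _; rewrite big_ord1 !mxE.
apply: class_C_sum => // i; apply: class_CZl => //; apply: class_CM => //.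
  apply: class_CV => //; first by rewrite finite_locusE.
  exact: class_C_mul_lift_sphere3.
exact: class_C_mul_lift_sphere3.
Qed.

(** Quotient rule for [V_o / V_5]; the last coordinate of the lift is constant, so its variation
    along [u] is [(u, 0)]. *)
Lemma diff_act_sphere3 M X u : finite_locus M X ->
  let V : 'cV[R]_(4 + 1) := M *m lift_sphere3 X in
  let dV : 'cV[R]_(4 + 1) := M *m (col_mx u 0 : 'cV[R]_(4 + 1)) in
  'd (act_sphere3 M) X u =
  (dsubmx V 0 0)^-1 *: (usubmx dV + - (dsubmx dV 0 0 / dsubmx V 0 0) *: usubmx V).
Proof.
move=> UX V dV; have [df _] := smooth_act_sphere3 M 1.
rewrite -deriveE; last exact: df.
rewrite derive_mx; last by apply: diff_derivable; exact: df.
apply/matrixP => i j; rewrite mxE ord1.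
have -> : (fun X => act_sphere3 M X i 0) = fun X => 
    ((M *m lift_sphere3 X) (rshift 4 (0 : 'I_1)) 0)^-1
      * (M *m lift_sphere3 X) (lshift 1 i) 0.
  by apply/funext => Y; rewrite /act_sphere3 !mxE.
have [d1 e1] := is_derive_mul_lift_sphere3 M (rshift 4 (0 : 'I_1)) X u.
have [d2 e2] := is_derive_mul_lift_sphere3 M (lshift 1 i) X u.
have V5 : V (rshift 4 (0 : 'I_1)) 0 != 0 by move: UX; rewrite finite_locusE.
rewrite (@deriveM _ _ (fun X => ((M *m lift_sphere3 X) (rshift 4 (0 : 'I_1)) 0)^-1)
  (fun X => (M *m lift_sphere3 X) (lshift 1 i) 0))//; last exact: derivableV.
rewrite deriveV// e1 e2 -/V -/dV; clearbody V dV; rewrite !mxE /GRing.scale /=.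
by field.
Qed.

Lemma conformal_act_sphere3 M X u v : SO41 M -> sphere3 X ->
    tangent_sphere3 X u -> tangent_sphere3 X v ->
  dot ('d (act_sphere3 M) X u) ('d (act_sphere3 M) X v) =
  (dsubmx (M *m lift_sphere3 X : 'cV[R]_(4 + 1)) 0 0) ^- 2 * dot u v.
Proof.
move=> SM SX Xu Xv; have V5 := act_sphere3_last_neq0 SM SX.
rewrite !diff_act_sphere3//.
(* Four Lorentz products of [(X, 1)], [(u, 0)], [(v, 0)] are collected; tangency kills the mixed
   ones, and invariance under [M] moves all four to [V], [du], [dv]. *)
have := (lorentz_lift_sphere3 SX).
have := lorentz_col_mx X u 1 0; have := lorentz_col_mx X v 1 0.
have := lorentz_col_mx u v 0 0.
have -> : const_mx 0 = 0 :> 'cV[R]_1 by apply/matrixP => i j; rewrite !mxE.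
rewrite -/(lift_sphere3 X) !mulr0 !subr0 (Xu : dot X u = 0) (Xv : dot X v = 0).
rewrite -!(SM.2 (lift_sphere3 X)) -(SM.2 (col_mx u 0)) /lorentz.
move: V5; set V := (M *m lift_sphere3 X : 'cV_(4 + 1)).
set du := (M *m col_mx u 0 : 'cV_(4 + 1)); set dv := (M *m col_mx v 0 : 'cV_(4 + 1)).
move: (dsubmx V 0 0) (dsubmx du 0 0) (dsubmx dv 0 0) => a b c a0.
move=> uv /eqP + /eqP + /eqP; rewrite !subr_eq0 => /eqP Vv /eqP Vu /eqP VV.
(* On spatial parts, [V.V = a^2], [V.du = a b] and [V.dv = a c]: the corrections [- b c - b c + b c]
   leave [du.dv - b c], which is [dot u v]. *)
rewrite !(dotZl, dotZr, dotDl, dotDr) (dotC (usubmx du) (usubmx V)).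
rewrite -uv Vv Vu VV; field.
exact: a0.
Qed.

Lemma conformal_diffeo_act_sphere3 M : SO41 M -> conformal_diffeo_sphere3 (act_sphere3 M).
Proof.
have ext N p : SO41 N -> sphere3 p ->
    local_smooth_extension sphere3 (act_sphere3 N) p (finite_locus N) (act_sphere3 N).
  move=> SN Sp; split=> //; [exact: open_finite_locus| |exact: smooth_act_sphere3].
  exact: act_sphere3_last_neq0.
have smooth N : SO41 N -> smooth_on (@sphere3 R) (act_sphere3 N).
  by move=> SN p Sp; exists (finite_locus N), (act_sphere3 N); exact: ext.
have [_ _ SV] := @SO41_matrix_group R.
move=> SM; have [uM SVM] := SV _ SM; split; last first.
  move=> p Sp; exists (finite_locus M), (act_sphere3 M); split; first exact: ext.
  exists (dsubmx (M *m lift_sphere3 p : 'cV[R]_(4 + 1)) 0 0 ^- 2).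
    by rewrite invr_gt0 exprn_even_gt0//=; exact: act_sphere3_last_neq0.
  by move=> u v; exact: conformal_act_sphere3.
split; [by move=> p; exact: act_sphere3_stable|exact: smooth|].
exists (act_sphere3 (invmx M)); split=> [p|||].
- exact: act_sphere3_stable.
- exact: smooth.
- by move=> x Sx; rewrite -act_sphere3_comp// mulVmx// act_sphere3_1.
- by move=> x Sx; rewrite -act_sphere3_comp// mulmxV// act_sphere3_1.
Qed.

End Conformal.

(** * Transport to R^3 U {oo} by stereographic projection *)

Section Stereo.
Context {R : realType}.
Implicit Types (M N : 'M[R]_5) (X : 'cV[R]_4) (x : @R3oo R).

(** The projection from null vectors to R^3 U {oo} through which both [act_R3oo] and [stereo]
    factor. *)
Definition project_R3oo (y : 'cV[R]_(3 + (1 + 1))) : @R3oo R :=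
  let d := dsubmx (dsubmx y) 0 0 - usubmx (dsubmx y) 0 0 in
  if d == 0 then None else Some (d^-1 *: usubmx y).

Lemma act_R3ooE M x : act_R3oo M x = project_R3oo (M *m lift_R3oo x).
Proof. by []. Qed.

Lemma project_R3ooZ (c : R) y : c != 0 -> project_R3oo (c *: y) = project_R3oo y.
Proof.
move=> c0; rewrite /project_R3oo.
have -> : usubmx (c *: y) = c *: usubmx y by apply/matrixP => i j; rewrite !mxE.
have -> : dsubmx (dsubmx (c *: y)) 0 0 - usubmx (dsubmx (c *: y)) 0 0 =
    c * (dsubmx (dsubmx y) 0 0 - usubmx (dsubmx y) 0 0).
  by rewrite mulrBr !mxE.
by rewrite mulf_eq0 (negPf c0) scalerA invfM mulrAC mulVf ?mul1r.
Qed.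

Lemma lift_sphere3E (X : 'cV[R]_(3 + 1)) :
  lift_sphere3 X = col_mx (usubmx X) (col_mx (dsubmx X) (const_mx 1)).
Proof.
(* Reassociating the blocks introduces a cast between convertible dimensions, hence an identity. *)
by rewrite col_mxA vsubmxK; apply: esym; exact: castmx_id.
Qed.

Lemma stereoE (X : 'cV[R]_(3 + 1)) : stereo X = project_R3oo (lift_sphere3 X).
Proof.
rewrite /stereo /project_R3oo lift_sphere3E !(col_mxKu, col_mxKd) [const_mx _ _ _]mxE.
by rewrite subr_eq0 eq_sym.
Qed.

Lemma dot_col_mx m n (a c : 'cV[R]_m) (b d : 'cV[R]_n) :
  dot (col_mx a b) (col_mx c d) = dot a c + dot b d.
Proof. by rewrite !dotE tr_col_mx mul_row_col mxE. Qed.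

Lemma sphere3E (X : 'cV[R]_(3 + 1)) :
  sphere3 X <-> dot (usubmx X) (usubmx X) = 1 - dsubmx X 0 0 ^+ 2.
Proof.
have XX : dot X X = dot (usubmx X) (usubmx X) + dsubmx X 0 0 ^+ 2.
  by rewrite -{1 2}(vsubmxK X) dot_col_mx [dot (dsubmx X) _]big_ord1 expr2.
rewrite /sphere3 /= XX.
by split=> [<-|->]; rewrite ?addrK ?subrK.
Qed.

(** Away from the pole, [|x|^2 = (1 + t) / (1 - t)], so the last two coordinates of the lift are
    [t / (1 - t)] and [1 / (1 - t)], and the factor is [(1 - t)^-1]; at the pole it is 1. *)
Lemma lift_stereo X : sphere3 X ->
  exists2 c : R, c != 0 & lift_R3oo (stereo X) = c *: lift_sphere3 X.
Proof.
move=> /sphere3E; rewrite lift_sphere3E /stereo.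
rewrite (mx11_scalar (dsubmx (X : 'cV_(3 + 1)))) [_%:M 0 0]mxE mulr1n.
set t := dsubmx _ 0 0; case: ifPn => [/eqP ->|t1] Xt.
  exists 1; rewrite ?oner_neq0// scale1r.
  move: Xt; rewrite expr1n subrr => /eqP; rewrite dot_eq0 => /eqP ->.
  by congr (col_mx _ (col_mx _ _)); apply/matrixP => i j; rewrite !mxE !ord1.
have t0 : 1 - t != 0 by rewrite subr_eq0 eq_sym.
exists (1 - t)^-1; first by rewrite invr_eq0.
rewrite -[RHS]/((1 - t)^-1 *: (col_mx _ (col_mx _ _) : 'cV_(3 + (1 + 1)))).
rewrite /= dotZl dotZr Xt !scale_col_mx.
congr (col_mx _ (col_mx _ _)); apply/matrixP => i j; rewrite !mxE ?ord1 ?mulr1n /=;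
  field; exact: t0.
Qed.

Lemma stereo_surj x : exists2 X, sphere3 X & stereo X = x.
Proof.
case: x => [x|].
  have x1 : dot x x + 1 != 0.
    by rewrite gt_eqF// ltr_wpDl// sumr_ge0// => i _; rewrite -expr2 sqr_ge0.
  (* Inverse stereographic projection: [c] is the value of [1 - t] at the preimage of [x]. *)
  pose c := 2 / (dot x x + 1).
  have c0 : c != 0 by rewrite mulf_neq0 ?invr_neq0// pnatr_eq0.
  exists (col_mx (c *: x) (const_mx (1 - c)) : 'cV_(3 + 1)).
    apply/sphere3E; rewrite col_mxKu col_mxKd mxE dotZl dotZr /c; field; exact: x1.
  rewrite /stereo col_mxKu col_mxKd mxE subKr scalerA mulVf// scale1r.
  by rewrite -subr_eq0 addrAC subrr sub0r oppr_eq0 (negPf c0).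
exists (col_mx 0 (const_mx 1) : 'cV_(3 + 1)).
  apply/sphere3E; rewrite col_mxKu col_mxKd mxE expr1n subrr.
  by apply/eqP; rewrite dot_eq0.
by rewrite /stereo col_mxKd mxE eqxx.
Qed.

(** Both sides project nonzero multiples of the same null vector [M *m lift_sphere3 X]. This
    equivariance transports the action laws, transitivity and conformality. *)
Lemma stereo_act_sphere3 M X : SO41 M -> sphere3 X ->
  stereo (act_sphere3 M X) = act_R3oo M (stereo X).
Proof.
move=> SM SX; have [c c0 cX] := lift_stereo SX.
rewrite act_R3ooE cX -scalemxAr project_R3ooZ// (lift_act_sphere3 SM SX).
by rewrite project_R3ooZ ?stereoE//; exact: act_sphere3_last_neq0.
Qed.

Lemma transitive_action_R3oo : transitive_action SO41 [set: @R3oo R] act_R3oo.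
Proof.
split.
  split=> [|//|x _|M N x SM SN _]; first exact: SO41_matrix_group.
    have [X SX <-] := stereo_surj x.
    rewrite -stereo_act_sphere3 ?act_sphere3_1//.
    by case: (@SO41_matrix_group R).
  have [X SX <-] := stereo_surj x.
  have SMN : SO41 (M *m N) by case: (@SO41_matrix_group R) => _ SMul _; exact: SMul.
  rewrite -!stereo_act_sphere3 ?act_sphere3_comp//; exact: act_sphere3_stable.
move=> x y _ _; have [X SX <-] := stereo_surj x; have [Y SY <-] := stereo_surj y.
have [M SM MX] := (@transitive_action_sphere3 R).2 X Y SX SY.
by exists M; rewrite // -stereo_act_sphere3// MX.
Qed.

End Stereo.

Theorem proposition1p2 (R : realType) :
  [/\ forall (M : 'M[R]_5) (X : 'cV[R]_4), SO41 M -> sphere3 X ->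
        dsubmx (M *m lift_sphere3 X : 'cV[R]_(4 + 1)) 0 0 != 0,
      transitive_action (@SO41 R) sphere3 act_sphere3,
      forall M : 'M[R]_5, SO41 M -> conformal_diffeo_sphere3 (act_sphere3 M),
      transitive_action (@SO41 R) setT act_R3oo &
      forall M : 'M[R]_5, SO41 M -> conformal_diffeo_R3oo (act_R3oo M)].
Proof.
split; [exact: act_sphere3_last_neq0|exact: transitive_action_sphere3|
  exact: conformal_diffeo_act_sphere3|exact: transitive_action_R3oo|].
move=> M SM; exists (act_sphere3 M); first exact: conformal_diffeo_act_sphere3.
by move=> X SX; exact: stereo_act_sphere3.
Qed.
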